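(* The lattice $\mathsf{B}(2,2)$ does not satisfy the lattice identity $(\mathrm{Veg}_2)$. In particular, $\mathsf{B}(2,2)$ cannot be embedded (as a lattice) into any Tamari lattice $\mathsf{A}(\ell)$ ($\ell$ a positive integer).
   Context: For natural numbers $m,n$, $\mathsf{B}(m,n)$ is the lattice obtained by doubling the join of $m$ atoms in the Boolean lattice with $m+n$ atoms: take the finite Boolean lattice $B$ with atoms $\boldsymbol a_1,\dots,\boldsymbol a_m,\boldsymbol b_1,\dots,\boldsymbol b_n$, put $\boldsymbol a=\boldsymbol a_1\vee\dots\vee\boldsymbol a_m$, and let $\mathsf{B}(m,n)=B\cup\{\boldsymbol p\}$ with a new element $\boldsymbol p$, where the order extends that of $B$ and, for $x\in B$, $x<\boldsymbol p$ iff $x\le\boldsymbol a$, and $\boldsymbol p<x$ iff $\boldsymbol a<x$. Tamari lattices: with $[\ell]=\{1,\dots,\ell\}$ and $\mathcal{I}_\ell=\{(i,j)\in[\ell]\times[\ell] : i<j\}$, $\mathsf{A}(\ell)$ is the set of all transitive subsets $\boldsymbol{x}\subseteq\mathcal{I}_\ell$ such that $1\le i<j<k\le\ell$ and $(i,k)\in\boldsymbol{x}$ imply $(i,j)\in\boldsymbol{x}$, ordered by inclusion; it is a lattice. A lattice embedding is an injective map preserving binary meets and joins. A lattice satisfies an identity if it holds for every assignment of elements of the lattice to the variables. The identity $(\mathrm{Veg}_2)$, in the variables $\mathsf a_1,\mathsf a_2,\mathsf b_1,\mathsf b_2$, is $$(\mathsf a_1\vee\mathsf a_2\vee\mathsf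 b_1)\wedge(\mathsf a_1\vee\mathsf a_2\vee\mathsf b_2)=\bigvee_{i,j\in\{1,2\}}\bigl((\mathsf a_i\vee\tilde{\mathsf b}_j)\wedge(\mathsf a_1\vee\mathsf a_2\vee\mathsf b_{3-j})\bigr),$$ where $\tilde{\mathsf b}_j=(\mathsf b_1\vee\mathsf b_2)\wedge(\mathsf a_1\vee\mathsf a_2\vee\mathsf b_j)$ for $j\in\{1,2\}$. *)

(* Defs.v *)
From HB Require Import structures.
From mathcomp Require Import all_boot all_order.

Set Implicit Arguments.
Unset Strict Implicit.
Unset Printing Implicit Defensive.

Definition satisfies_Veg2 (d : Order.disp_t) (L : latticeType d) : Prop :=
  forall a1 a2 b1 b2 : L,
    let t1 := ((b1 `|` b2) `&` (a1 `|` a2 `|` b1))%O in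
    let t2 := ((b1 `|` b2) `&` (a1 `|` a2 `|` b2))%O in
    ((a1 `|` a2 `|` b1) `&` (a1 `|` a2 `|` b2) =
       ((a1 `|` t1) `&` (a1 `|` a2 `|` b2)) `|`
       ((a1 `|` t2) `&` (a1 `|` a2 `|` b1)) `|`
       ((a2 `|` t1) `&` (a1 `|` a2 `|` b2)) `|`
       ((a2 `|` t2) `&` (a1 `|` a2 `|` b1)))%O.

Definition lattice_embedding (d d' : Order.disp_t)
    (L : latticeType d) (M : latticeType d') (f : L -> M) : Prop :=
  [/\ injective f, Order.meet_morphism f & Order.join_morphism f].

(* The Boolean lattice with m + n atoms is the powerset of 'I_m + 'I_n, the
   atoms a_i and b_j being [set inl i] and [set inr j].  In dbool m n, Some x
   is the element x of that lattice and None is the new element p. *)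
Definition dbool (m n : nat) : Type := option {set 'I_m + 'I_n}.

HB.instance Definition _ m n := Finite.on (dbool m n).

Definition dbool_a (m n : nat) : {set 'I_m + 'I_n} :=
  \bigcup_(i < m) [set inl i].

Section DBool.
Variables m n : nat.
Implicit Types u v w : dbool m n.
Local Notation a := (dbool_a m n).

Definition dbool_le u v : bool :=
  match u, v with
  | Some x, Some y => x \subset y
  | Some x, None => x \subset a
  | None, Some y => a \proper y
  | None, None => true
  end.

(* Two elements of the Boolean lattice lying strictly above a and meeting in a
   there have p as their meet. *)
Definition dbool_meet u v : dbool m n :=
  match u, v with
  | Some x, Some y =>
      if [&& a \proper x, a \proper y & x :&: y == a] then None
      else Some (x :&: y)
  | Some x, None | None, Some x =>
      if a \proper x then None else Some (x :&: a)
  | None, None => None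
  end.

Definition dbool_join u v : dbool m n :=
  match u, v with
  | Some x, Some y => Some (x :|: y)
  | Some x, None | None, Some x =>
      if x \subset a then None else Some (x :|: a)
  | None, None => None
  end.

Lemma dbool_le_refl : reflexive dbool_le.
Proof. by case=> [x|] /=. Qed.

Lemma dbool_le_anti : antisymmetric dbool_le.
Proof.
case=> [x|] [y|] //=.
- by move=> xy; congr Some; apply/eqP; rewrite eqEsubset.
- by case/andP=> xa /proper_subn; rewrite xa.
- by case/andP=> /proper_subn + xa; rewrite xa.
Qed.

Lemma dbool_le_trans : transitive dbool_le.
Proof.
case=> [y|] [x|] [z|] //=.
- exact: subset_trans.
- exact: subset_trans.
- exact: proper_sub_trans.
- by move=> xa /proper_sub; apply: subset_trans.
Qed.

Lemma dbool_meetP u v w :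
  dbool_le u (dbool_meet v w) = dbool_le u v && dbool_le u w.
Proof.
case: u v w => [x|] [y|] [z|] //=.
- case: ifP => [/and3P[_ _ /eqP <-]|_] /=; by rewrite subsetI.
- case: ifP => /= [/proper_sub ay|_]; last by rewrite subsetI.
  by case: (boolP (x \subset a)) => [xa|]; rewrite ?andbF // (subset_trans xa ay).
- case: ifP => /= [/proper_sub ay|_]; last by rewrite subsetI andbC.
  by case: (boolP (x \subset a)) => [xa|]; rewrite ?andbF // (subset_trans xa ay).
- by rewrite andbb.
- case: ifP => [/and3P[-> -> _] //|h] /=; move: h.
  rewrite !properE subsetI eqEsubset subsetI.
  case: (a \subset y); case: (a \subset z); rewrite ?andbF //= andbT.
  have [ya _|_] := boolP (y \subset a).
    by rewrite (subset_trans (subsetIl _ _) ya).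
  have [za _|_ /= ->] := boolP (z \subset a) => //.
  by rewrite (subset_trans (subsetIr _ _) za).
- by case: ifP => //= _; rewrite properE subsetIr andbF.
- by case: ifP => //= _; rewrite properE subsetIr andbF.
Qed.

Lemma dbool_joinP u v w :
  dbool_le (dbool_join u v) w = dbool_le u w && dbool_le v w.
Proof.
case: u v w => [x|] [y|] [z|] //=; rewrite ?subUset ?andbT ?andbb //.
- case: ifP => /= xa.
    by apply/idP/andP => [az|[]//]; rewrite (subset_trans xa (proper_sub az)).
  rewrite subUset properE; case: (boolP (x \subset z)) => //= xz.
  case: (boolP (a \subset z)) => //= az; apply/esym/negP => za.
  by rewrite (subset_trans xz za) in xa.
- by case: ifP => //= xa; rewrite subUset xa.
- case: ifP => /= xa.
    by apply/idP/andP => [az|[]//]; rewrite (subset_trans xa (proper_sub az)).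
  rewrite subUset properE andbC [RHS]andbC; case: (boolP (y \subset z)) => //= xz;
    last by rewrite andbF.
  rewrite andbT; case: (boolP (a \subset z)) => //= az; apply/esym/negP => za.
  by rewrite (subset_trans xz za) in xa.
- by case: ifP => //= xa; rewrite subUset xa.
Qed.

End DBool.

Fact dbool_display : Order.disp_t. Proof. exact: Order.Disp tt tt. Qed.

HB.instance Definition _ m n :=
  Order.Le_isPOrder.Build dbool_display (dbool m n)
    (@dbool_le_refl m n) (@dbool_le_anti m n) (@dbool_le_trans m n).

HB.instance Definition _ m n :=
  Order.POrder_MeetJoin_isLattice.Build dbool_display (dbool m n)
    (@dbool_meetP m n) (@dbool_joinP m n).

(* The index set {1, ..., l} is represented by 'I_l. *)
Definition is_tamari (l : nat) (x : {set 'I_l * 'I_l}) : bool :=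
  [&& x \subset [set ij : 'I_l * 'I_l | ij.1 < ij.2],
      [forall i, forall j, forall k,
         ((i, j) \in x) && ((j, k) \in x) ==> ((i, k) \in x)]
    & [forall i : 'I_l, forall j : 'I_l, forall k : 'I_l,
         [&& i < j, j < k & (i, k) \in x] ==> ((i, j) \in x)]].

Record tamari (l : nat) := Tamari {
  tamari_set :> {set 'I_l * 'I_l};
  _ : is_tamari tamari_set
}.

HB.instance Definition _ l := [isSub for @tamari_set l].
HB.instance Definition _ l := [Finite of tamari l by <:].

Section Tamari.
Variable l : nat.
Implicit Types x y z : tamari l.

Definition tamari_le x y : bool := tamari_set x \subset tamari_set y.

Lemma is_tamariP (x : {set 'I_l * 'I_l}) :
  reflect [/\ forall i j, (i, j) \in x -> i < j,
              forall i j k, (i, j) \in x -> (j, k) \in x -> (i, k) \in x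
            & forall i j k : 'I_l,
                i < j -> j < k -> (i, k) \in x -> (i, j) \in x]
          (is_tamari x).
Proof.
apply: (iffP and3P) => [[/subsetP h1 h2 h3]|[h1 h2 h3]]; split.
- by move=> i j /h1; rewrite inE.
- move=> i j k ij jk; move/forallP: h2 => /(_ i)/forallP/(_ j)/forallP/(_ k).
  by rewrite ij jk.
- move=> i j k ij jk ik; move/forallP: h3 => /(_ i)/forallP/(_ j)/forallP/(_ k).
  by rewrite ij jk ik.
- by apply/subsetP => -[i j] /h1; rewrite inE.
- apply/'forall_'forall_forallP => i j k; apply/implyP => /andP[]; exact: h2.
- apply/'forall_'forall_forallP => i j k; apply/implyP => /and3P[]; exact: h3.
Qed.

Lemma is_tamari_meet x y : is_tamari (tamari_set x :&: tamari_set y).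
Proof.
case: x y => [x /is_tamariP[x1 x2 x3]] [y /is_tamariP[y1 y2 y3]] /=.
apply/is_tamariP; split=> [i j|i j k|i j k ij jk]; rewrite !inE.
- by case/andP=> /x1.
- by move=> /andP[h1 h2] /andP[h3 h4]; rewrite (x2 i j k) ?(y2 i j k).
- by move=> /andP[h1 h2]; rewrite (x3 i j k) ?(y3 i j k).
Qed.

Definition tamari_meet x y : tamari l := Tamari (is_tamari_meet x y).

Definition tamari_join_set x y : {set 'I_l * 'I_l} :=
  [set ij : 'I_l * 'I_l | (ij.1 < ij.2) &&
     [forall z : tamari l,
        tamari_le x z && tamari_le y z ==> (ij \in tamari_set z)]].

Lemma is_tamari_join x y : is_tamari (tamari_join_set x y).
Proof.
apply/is_tamariP; split=> [i j|i j k|i j k ij jk]; rewrite !inE /=.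
- by case/andP.
- case/andP=> ij /forallP h1 /andP[jk /forallP h2].
  rewrite (ltn_trans ij jk); apply/forallP => z; apply/implyP => xyz.
  have /is_tamariP[_ z2 _] := valP z.
  by apply: z2 (implyP (h1 z) xyz) (implyP (h2 z) xyz).
- case/andP=> ik /forallP h; rewrite ij; apply/forallP => z.
  apply/implyP => xyz; have /is_tamariP[_ _ z3] := valP z.
  exact: z3 ij jk (implyP (h z) xyz).
Qed.

(* The least element of tamari l containing x and y. *)
Definition tamari_join x y : tamari l := Tamari (is_tamari_join x y).

Lemma tamari_le_refl : reflexive tamari_le.
Proof. by move=> x; apply: subxx. Qed.

Lemma tamari_le_anti : antisymmetric tamari_le.
Proof. by move=> x y xy; apply/val_inj/eqP; rewrite eqEsubset. Qed.

Lemma tamari_le_trans : transitive tamari_le.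
Proof. by move=> y x z; apply: subset_trans. Qed.

Lemma tamari_meetP x y z :
  tamari_le x (tamari_meet y z) = tamari_le x y && tamari_le x z.
Proof. by rewrite /tamari_le subsetI. Qed.

Lemma tamari_joinP x y z :
  tamari_le (tamari_join x y) z = tamari_le x z && tamari_le y z.
Proof.
have ltP (w : tamari l) ij : ij \in tamari_set w -> ij.1 < ij.2.
  by case: ij => i j; have /is_tamariP[w1 _ _] := valP w; apply: w1.
have ub : tamari_le x (tamari_join x y) /\ tamari_le y (tamari_join x y).
  split; apply/subsetP => ij ijx; rewrite inE (ltP _ _ ijx) /=;
  apply/forallP => w; apply/implyP => /andP[/subsetP xw /subsetP yw].
    exact: xw.
  exact: yw.
apply/idP/idP => [jz|xyz].
  by rewrite (tamari_le_trans ub.1 jz) (tamari_le_trans ub.2 jz).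
apply/subsetP => ij; rewrite inE => /andP[_ /forallP/(_ z)].
by rewrite xyz.
Qed.

End Tamari.

Fact tamari_display : Order.disp_t. Proof. exact: Order.Disp tt tt. Qed.

HB.instance Definition _ l :=
  Order.Le_isPOrder.Build tamari_display (tamari l)
    (@tamari_le_refl l) (@tamari_le_anti l) (@tamari_le_trans l).

HB.instance Definition _ l :=
  Order.POrder_MeetJoin_isLattice.Build tamari_display (tamari l)
    (@tamari_meetP l) (@tamari_joinP l).

(* Main.v *)
Require Import Defs.
From mathcomp Require Import all_boot all_order.

(** In [B(2,2)] the atoms violate (Veg_2): the left hand side is the new element
    [p], the right hand side is [a].  Conversely every Tamari lattice satisfies
    (Veg_2).  Given [(i, j)] in the left hand side, the closure condition of
    [A(l)] and induction on [j] reduce the problem to finding [i <= c < j] with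
    [(c, j)] in the right hand side.  Joins are transitive closures, so one may
    look at the last steps ending in [j]: a step in [a_1] or [a_2] is fine, and
    otherwise [(k, j)] lies in some [tilde b_u].  Let [(c, k)] be a step of the
    chain from [i] witnessing the membership of [(i, j)] in [a_1 v a_2 v b_(3-u)].
    If it lies in [a_i], then [(c, j)] lies in the right hand side; if it lies in
    [b_(3-u)], then [(c, j)] lies in [tilde b_(3-u)] with [c < k], and one
    descends. *)

Set Implicit Arguments.
Unset Strict Implicit.
Unset Printing Implicit Defensive.

Import Order.TTheory.

Section Tamari.
Variable l : nat.
Implicit Types (x y z r t : tamari l) (i j k c : 'I_l).

(** * Pairs and chains of steps in Tamari lattices *)

Lemma tamari_lt x i j : (i, j) \in tamari_set x -> i < j.
Proof. by have /is_tamariP[h _ _] := valP x; apply: h. Qed.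

Lemma tamari_trans x i j k :
  (i, j) \in tamari_set x -> (j, k) \in tamari_set x -> (i, k) \in tamari_set x.
Proof. by have /is_tamariP[_ h _] := valP x; apply: h. Qed.

Lemma tamari_left x i j k : i < j -> j <= k ->
  (i, k) \in tamari_set x -> (i, j) \in tamari_set x.
Proof.
move=> ij; rewrite leq_eqVlt => /predU1P[/val_inj -> //|jk].
by have /is_tamariP[_ _ h] := valP x; apply: h.
Qed.

Lemma tamari_leP x y :
  reflect (forall i j, (i, j) \in tamari_set x -> (i, j) \in tamari_set y)
          (x <= y)%O.
Proof.
by apply: (iffP subsetP) => [h i j|h [i j]]; apply: h.
Qed.

Lemma in_tamari_meet x y i j :
  ((i, j) \in tamari_set (x `&` y)%O) =
  ((i, j) \in tamari_set x) && ((i, j) \in tamari_set y).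
Proof. by rewrite inE. Qed.

Lemma in_tamari_joinl x y i j :
  (i, j) \in tamari_set x -> (i, j) \in tamari_set (x `|` y)%O.
Proof. exact/tamari_leP/leUl. Qed.

Lemma in_tamari_joinr x y i j :
  (i, j) \in tamari_set y -> (i, j) \in tamari_set (x `|` y)%O.
Proof. exact/tamari_leP/leUr. Qed.

(* The pairs of [x] are compositions of chains of [P]-steps lying in [x], and
   truncating such a chain at [k] yields a last step [(c, k)] in [P]. *)
Definition chained (P : rel 'I_l) x := forall i j k,
  (i, j) \in tamari_set x -> i < k -> k <= j ->
  exists c, [/\ i <= c, c < k, P c k & (c, j) \in tamari_set x].

Lemma chained_sub (P : rel 'I_l) x :
  (forall i j, (i, j) \in tamari_set x -> P i j) -> chained P x.
Proof.
by move=> xP i j k xij ik kj; exists i; split=> //; apply/xP/(tamari_left (k := j)).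
Qed.

(** The pairs of the join that have the required truncations form an element of [tamari l] above [x]
    and [y], so by minimality they exhaust the join. *)
Lemma chained_join (P : rel 'I_l) x y :
  chained P x -> chained P y -> chained P (x `|` y)%O.
Proof.
move=> Px Py.
pose Q i j := [forall k : 'I_l, (i < k <= j) ==>
  [exists c : 'I_l, [&& i <= c, c < k, P c k
                      & (c, j) \in tamari_set (x `|` y)%O]]].
have QP i j : reflect (forall k, i < k -> k <= j -> exists c,
    [/\ i <= c, c < k, P c k & (c, j) \in tamari_set (x `|` y)%O]) (Q i j).
  apply: (iffP forallP) => [h k ik kj|h k].
    have /existsP[c /and4P[]] : _ := implyP (h k) (introT andP (conj ik kj)).
    by exists c.
  apply/implyP => /andP[ik kj]; have [c [*]] := h k ik kj.
  by apply/existsP; exists c; apply/and4P.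
pose w := [set ij in tamari_set (x `|` y)%O | Q ij.1 ij.2].
have wE i j : ((i, j) \in w) = ((i, j) \in tamari_set (x `|` y)%O) && Q i j.
  by rewrite inE.
have w_tamari : is_tamari w.
  apply/is_tamariP; split=> [i j|i j k|i j k ij jk]; rewrite !wE.
  - by case/andP => /tamari_lt.
  - case/andP=> ij /QP Qij /andP[jk /QP Qjk]; rewrite (tamari_trans (j := j)) //=.
    (* A cut of the composite [(i, k)] falls into one factor; the step found there is kept, and the
       remainder is extended by transitivity if needed. *)
    apply/QP => m im mk; have [mj|jm] := leqP m j.
      have [c [ic cm Pcm cj]] := Qij m im mj.
      by exists c; split=> //; apply: tamari_trans cj jk.
    have [c [jc cm Pcm ck]] := Qjk m jm mk.
    by exists c; split=> //; apply: leq_trans jc; exact: ltnW (tamari_lt ij).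
  - case/andP=> ik /QP Qik; rewrite (tamari_left (k := k)) ?(ltnW jk) //=.
    apply/QP => m im mj.
    have [c [ic cm Pcm ck]] := Qik m im (leq_trans mj (ltnW jk)).
    exists c; split=> //; apply: tamari_left ck; last exact: ltnW.
    exact: leq_trans cm mj.
have xyw : (x `|` y <= Tamari w_tamari)%O.
  rewrite leUx; apply/andP; split; apply/tamari_leP => i j hij; rewrite wE.
    rewrite in_tamari_joinl //=; apply/QP => k ik kj.
    have [c [ic ck Pck cj]] := Px i j k hij ik kj.
    by exists c; split=> //; apply: in_tamari_joinl.
  rewrite in_tamari_joinr //=; apply/QP => k ik kj.
  have [c [ic ck Pck cj]] := Py i j k hij ik kj.
  by exists c; split=> //; apply: in_tamari_joinr.
by move=> i j k /(tamari_leP _ _ xyw); rewrite wE => /andP[_ /QP]; apply.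
Qed.

Lemma tamari_join3_step x y z i j k :
  (i, j) \in tamari_set (x `|` y `|` z)%O -> i < k -> k <= j ->
  exists c, [/\ i <= c, c < k,
    [|| (c, k) \in tamari_set x, (c, k) \in tamari_set y
      | (c, k) \in tamari_set z]
    & (c, j) \in tamari_set (x `|` y `|` z)%O].
Proof.
pose P c k := [|| (c, k) \in tamari_set x, (c, k) \in tamari_set y
                | (c, k) \in tamari_set z].
apply: (@chained_join P); first apply: chained_join.
all: by apply: chained_sub => ? ? h; rewrite /P h ?orbT.
Qed.

(** * The identity (Veg_2) in Tamari lattices *)

(** Here [x], [y] stand for [a1], [a2], and [t], [z] for [t1], [b2] or [t2], [b1]. A step [(c, k)]
    in [x] or [y] composes with [(k, j)] in [t] to a pair below [r]; a step in [z] leaves the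
    descent to continue from [c]. *)
Lemma veg2_descent_step x y z t r i j k :
  ((x `|` t) `&` (x `|` y `|` z) <= r)%O ->
  ((y `|` t) `&` (x `|` y `|` z) <= r)%O ->
  (i, j) \in tamari_set (x `|` y `|` z)%O ->
  i <= k -> (k, j) \in tamari_set t ->
  exists c, [/\ i <= c, c < j & (c, j) \in tamari_set r \/
    [/\ c < k, (c, k) \in tamari_set z & (c, j) \in tamari_set (x `|` y `|` z)%O]].
Proof.
move=> /tamari_leP xr /tamari_leP yr ij ik kj; have k_lt_j := tamari_lt kj.
move: ik; rewrite leq_eqVlt => /predU1P[/val_inj ?|ik].
  subst k; exists i; split=> //; left; apply: xr.
  by rewrite in_tamari_meet ij in_tamari_joinr.
have [c [ic ck h cj]] := tamari_join3_step ij ik (ltnW k_lt_j).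
exists c; split=> //; first exact: ltn_trans k_lt_j.
case/or3P: h => h; [left; apply: xr|left; apply: yr|by right].
all: rewrite in_tamari_meet cj andbT.
all: exact: tamari_trans (in_tamari_joinl _ h) (in_tamari_joinr _ kj).
Qed.

Lemma tamari_Veg2 : satisfies_Veg2 (tamari l).
Proof.
move=> a1 a2 b1 b2 t1 t2; set r := (RHS); apply/le_anti/andP.
have t1P : (t1 <= a1 `|` a2 `|` b1)%O by apply: leIr.
have t2P : (t2 <= a1 `|` a2 `|` b2)%O by apply: leIr.
have a1P z : (a1 <= a1 `|` a2 `|` z)%O by rewrite -joinA leUl.
have a2P z : (a2 <= a1 `|` a2 `|` z)%O by rewrite joinAC leUr.
have r11 : ((a1 `|` t1) `&` (a1 `|` a2 `|` b2) <= r)%O.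
  by rewrite /r -!joinA leUl.
have r12 : ((a1 `|` t2) `&` (a1 `|` a2 `|` b1) <= r)%O.
  by rewrite /r -!joinA lexU2 // leUl orbT.
have r21 : ((a2 `|` t1) `&` (a1 `|` a2 `|` b2) <= r)%O.
  exact: le_trans (leUr _ _) (leUl _ _).
have r22 : ((a2 `|` t2) `&` (a1 `|` a2 `|` b1) <= r)%O by rewrite leUr.
split; last first.
  rewrite /r !leUx -!andbA; apply/and4P; split; rewrite lexI.
  - by rewrite leIr leIxl // leUx a1P t1P.
  - by rewrite leIr leIxl // leUx a1P t2P.
  - by rewrite leIr leIxl // leUx a2P t1P.
  - by rewrite leIr leIxl // leUx a2P t2P.
have a1r : (a1 <= r)%O by apply: le_trans r11; rewrite lexI leUl a1P.
have a2r : (a2 <= r)%O by apply: le_trans r21; rewrite lexI leUl a2P.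
clearbody r.
(* Both alternatives enter the induction on [k], since each descent exchanges [t1] and [t2]. *)
have descent i j : (i, j) \in tamari_set (a1 `|` a2 `|` b1)%O ->
    (i, j) \in tamari_set (a1 `|` a2 `|` b2)%O -> forall k, i <= k ->
    (k, j) \in tamari_set t1 \/ (k, j) \in tamari_set t2 ->
    exists c, [/\ i <= c, c < j & (c, j) \in tamari_set r].
  move=> ij1 ij2 k; have [n] := ubnP k; elim: n k => // n IHn k kn ik [] kj.
    have [c [ic cj [cr|[ck cz cj2]]]] :=
      veg2_descent_step r11 r21 ij2 ik kj.
      by exists c.
    apply: (IHn c) => //; first by apply: leq_trans ck _.
    right; rewrite in_tamari_meet cj2 andbT; apply: (tamari_trans (j := k)).
      exact: in_tamari_joinr.
    by move: kj; rewrite in_tamari_meet => /andP[].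
  have [c [ic cj [cr|[ck cz cj1]]]] :=
    veg2_descent_step r12 r22 ij1 ik kj.
    by exists c.
  apply: (IHn c) => //; first by apply: leq_trans ck _.
  left; rewrite in_tamari_meet cj1 andbT; apply: (tamari_trans (j := k)).
    exact: in_tamari_joinl.
  by move: kj; rewrite in_tamari_meet => /andP[].
apply/tamari_leP => i j; have [n] := ubnP j; elim: n j => // n IHn j jn.
rewrite in_tamari_meet => /andP[ij1 ij2]; have ij := tamari_lt ij1.
(* If [i < c], truncation keeps [(i, c)] in the left hand side, so induction puts it in [r], where
   it composes with [(c, j)]. *)
suff [c [ic cj cr]] : exists c, [/\ i <= c, c < j & (c, j) \in tamari_set r].
  move: ic; rewrite leq_eqVlt => /predU1P[/val_inj -> //|ic].
  apply: (tamari_trans (j := c)) => //; apply: IHn; first by apply: leq_trans cj _.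
  by rewrite in_tamari_meet !(tamari_left ic (ltnW cj)).
have [c [ic cj h _]] := tamari_join3_step ij1 ij (leqnn j).
case/or3P: h => h.
- by exists c; split=> //; apply: (tamari_leP _ _ a1r).
- by exists c; split=> //; apply: (tamari_leP _ _ a2r).
(* A step in [b1] lies in [t1] and starts the descent. *)
- apply: (descent i j ij1 ij2 c ic); left.
  by rewrite in_tamari_meet in_tamari_joinl // in_tamari_joinr.
Qed.

End Tamari.

Lemma Veg2_embedding (d d' : Order.disp_t) (L : latticeType d)
    (M : latticeType d') (f : L -> M) :
  lattice_embedding f -> satisfies_Veg2 M -> satisfies_Veg2 L.
Proof.
move=> [f_inj fI fU] vegM a1 a2 b1 b2 t1 t2; apply: f_inj.
by rewrite /t1 /t2 !(fI, fU); apply: vegM.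
Qed.

(** * Failure of (Veg_2) in B(2,2) *)

Lemma in_dbool_a m n (s : 'I_m + 'I_n) :
  (s \in dbool_a m n) = (if s is inl _ then true else false).
Proof.
apply/bigcupP/idP => [[i _ /set1P -> //]|]; case: s => // i _.
by exists i; rewrite ?set11.
Qed.

Lemma dbool_meet_Some m n (x y : {set 'I_m + 'I_n}) :
  ~~ (dbool_a m n \subset x) ->
  ((Some x : dbool m n) `&` (Some y : dbool m n))%O = Some (x :&: y).
Proof. by move=> ax; rewrite /Order.meet /= properE (negPf ax). Qed.

Lemma dbool_join_Some m n (x y : {set 'I_m + 'I_n}) :
  ((Some x : dbool m n) `|` (Some y : dbool m n))%O = Some (x :|: y).
Proof. by []. Qed.

Lemma dbool22_not_Veg2 : ~ satisfies_Veg2 (dbool 2 2).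
Proof.
pose i0 : 'I_2 := ord0; pose i1 : 'I_2 := ord_max.
have I2 (i : 'I_2) : i = i0 \/ i = i1.
  by case: i => [[|[|//]] hi]; [left|right]; apply: val_inj.
have notsub (j : 'I_2) (x : {set 'I_2 + 'I_2}) :
    inl j \notin x -> ~~ (dbool_a 2 2 \subset x).
  by apply: contra => /subsetP; apply; rewrite in_dbool_a.
move=> /(_ (Some [set inl i0]) (Some [set inl i1])
           (Some [set inr i0]) (Some [set inr i1])) /=.
rewrite !dbool_join_Some.
(* Every meet on the right hand side has an argument missing some [inl i], hence is a plain
   intersection. *)
rewrite !(@dbool_meet_Some 2 2 ([set inr i0] :|: [set inr i1])); last 2 first.
- by apply: (notsub i0); rewrite !inE.
- by apply: (notsub i0); rewrite !inE.
rewrite !dbool_join_Some.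
rewrite !(@dbool_meet_Some 2 2 ([set inl i0] :|: _)); last 2 first.
- by apply: (notsub i1); rewrite !inE.
- by apply: (notsub i1); rewrite !inE.
rewrite !(@dbool_meet_Some 2 2 ([set inl i1] :|: _)); last 2 first.
- by apply: (notsub i0); rewrite !inE.
- by apply: (notsub i0); rewrite !inE.
(* On the left, both arguments lie strictly above [a] and intersect in [a], so the meet is [None],
   while the right hand side is a [Some]. *)
rewrite !dbool_join_Some /Order.meet /= ifT //.
apply/and3P; split.
- rewrite properE; apply/andP; split.
    apply/subsetP => -[] s; rewrite in_dbool_a // !inE => _.
    by case: (I2 s) => ->.
  by apply/subsetPn; exists (inr i0); rewrite ?in_dbool_a ?inE.
- rewrite properE; apply/andP; split.
    apply/subsetP => -[] s; rewrite in_dbool_a // !inE => _.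
    by case: (I2 s) => ->.
  by apply/subsetPn; exists (inr i1); rewrite ?in_dbool_a ?inE.
- by apply/eqP/setP => -[] s; rewrite in_dbool_a !inE; case: (I2 s) => ->.
Qed.

Theorem corollary9p3 :
  ~ satisfies_Veg2 (dbool 2 2) /\
  (forall l : nat, 0 < l ->
     ~ exists f : dbool 2 2 -> tamari l, lattice_embedding f).
Proof.
split=> [|l _ [f /Veg2_embedding f_veg]]; first exact: dbool22_not_Veg2.
exact/dbool22_not_Veg2/f_veg/tamari_Veg2.
Qed.
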